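(* For every positive integer $n$, $$\tilde{R}(\dot Q_2^{(brbb)},Q_n)=\tilde{R}(\dot Q_2^{(brrb)},Q_n)=\tilde{R}(\dot Q_2^{(rrbb)},Q_n)=2n,$$ and $$2n\le \tilde{R}(\dot Q_2^{(rbbb)},Q_n)\le 2n+O\!\left(\tfrac{n}{\log n}\right).$$
   Context: $Q_N$ is the Boolean lattice of all subsets of an $N$-element set ordered by inclusion. $Q_2$ has vertices $\varnothing,\{1\},\{2\},\{1,2\}$. The colored posets are: $\dot Q_2^{(brbb)}$: minimum $\varnothing$ blue, one middle vertex red, the other middle vertex blue, maximum blue; $\dot Q_2^{(brrb)}$: minimum blue, both middle vertices red, maximum blue; $\dot Q_2^{(rrbb)}$: minimum red, one middle vertex red, the other middle vertex blue, maximum blue; $\dot Q_2^{(rbbb)}$: minimum red, both middle vertices and the maximum blue. In a blue/red coloring of $Q_N$, a copy of a colored poset $\dot P$ is an induced subposet isomorphic to $P$ whose vertices have the colors of the corresponding vertices of $\dot P$. The poset Erdős–Hajnal number $\tilde{R}(\dot P,Q_n)$ is the minimum $N$ such that every blue/red coloring of $Q_N$ contains a copy of $\dot P$ or a monochromatic induced copy of $Q_n$. *)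

(* Defs.v *)
From mathcomp Require Import all_boot.
From Stdlib Require Import Reals.

Set Implicit Arguments.
Unset Strict Implicit.
Unset Printing Implicit Defensive.

(* Q_N is the Boolean lattice {set 'I_N} ordered by \subset. *)
Inductive color := Blue | Red.

Definition coloring (N : nat) := {set 'I_N} -> color.

Definition order_embedding (k N : nat) (f : {set 'I_k} -> {set 'I_N}) : Prop :=
  injective f /\ forall A B : {set 'I_k}, A \subset B <-> f A \subset f B.

Definition ord1_2 : 'I_2 := @Ordinal 2 1 isT.
Definition Q2col (cmin cmid0 cmid1 cmax : color) : {set 'I_2} -> color :=
  fun A => if A == set0 then cmin
           else if A == [set ord0] then cmid0
           else if A == [set ord1_2] then cmid1
           else cmax.

Definition Q2_brbb := Q2col Blue Red Blue Blue.
Definition Q2_brrb := Q2col Blue Red Red Blue.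
Definition Q2_rrbb := Q2col Red Red Blue Blue.
Definition Q2_rbbb := Q2col Red Blue Blue Blue.

Definition has_colored_Q2_copy (N : nat) (c : coloring N) (P : {set 'I_2} -> color) : Prop :=
  exists f : {set 'I_2} -> {set 'I_N},
    order_embedding f /\ forall A, c (f A) = P A.

Definition has_mono_Qn_copy (N n : nat) (c : coloring N) : Prop :=
  exists (f : {set 'I_n} -> {set 'I_N}) (k : color),
    order_embedding f /\ forall A, c (f A) = k.

Definition EH_property (P : {set 'I_2} -> color) (n N : nat) : Prop :=
  forall c : coloring N, has_colored_Q2_copy c P \/ has_mono_Qn_copy n c.

Definition EH_number_is (P : {set 'I_2} -> color) (n m : nat) : Prop :=
  EH_property P n m /\ forall M, M < m -> ~ EH_property P n M.

Definition EH_number_exists (P : {set 'I_2} -> color) (n : nat) : Prop :=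
  exists N, EH_property P n N.

Definition EH_number_ge (P : {set 'I_2} -> color) (n m : nat) : Prop :=
  forall M, M < m -> ~ EH_property P n M.

Definition EH_number_le_R (P : {set 'I_2} -> color) (n : nat) (x : R) : Prop :=
  exists N, (INR N <= x)%R /\ EH_property P n N.

(* Main.v *)
(* Lower bounds: color the sets of size less than [n] blue and all others red;
   then no red set lies below a blue one, and each color has only [n] layers.

   Upper bounds for [brbb] and [brrb]: split the ground set into [X] and [Y] of
   size [n] and send [A] included in [X] to a red set between [A] and
   [A :|: Y].  Such a set is forced unless [A] and [A :|: Y] lie between two
   blue sets, and without the forbidden copy such blue intervals are rigid: in
   [brrb] their red sets form a chain, in [brbb] their interior is
   monochromatic.

   Upper bound for [rrbb]: intervals from a red to a blue set have
   monochromatic interior, so a red set of size less than [n], or a blue set of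
   size more than [n], already yields a monochromatic [Q_n].

   Upper bound for [rbbb]: if all sets of size at most [n] are blue we are
   done.  Otherwise take a red [S] of size at most [n]; if there is no red [Q_n]
   above [S], each ordering of a [k]-set [Y] is followed by a chain of blue sets
   above [S].  The top of the chain determines the ordering, so [k! <= 2 ^ n]. *)
Require Import Defs.
From mathcomp Require Import all_boot.
From Stdlib Require Import Reals.
From mathcomp Require Import zify.
From Stdlib Require Import Classical Lra.

Set Implicit Arguments.
Unset Strict Implicit.
Unset Printing Implicit Defensive.

(** * Copies of [Q_n] and of colored diamonds from maps of sets *)

Definition is_blue (k : color) := if k is Blue then true else false.

Lemma is_blueP k : reflect (k = Blue) (is_blue k).
Proof. by case: k; constructor. Qed.

Lemma is_redP k : reflect (k = Red) (~~ is_blue k).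
Proof. by case: k; constructor. Qed.

Lemma subset_of_card (T : finType) (A : {set T}) m :
  m <= #|A| -> exists2 B : {set T}, B \subset A & #|B| = m.
Proof.
move=> /card_geqP[s [us ss sA]]; exists [set x in s].
  by apply/subsetP=> x; rewrite inE; apply: sA.
by rewrite cardsE -ss; apply/card_uniqP.
Qed.

(** Intersecting with [X] undoes [F], so [F] reflects inclusion among subsets of [X]; an injection
    of ['I_n] into [X] then gives the embedding. *)
Lemma mono_copy N n (c : coloring N) (k : color) (X : {set 'I_N})
    (F : {set 'I_N} -> {set 'I_N}) :
  n <= #|X| ->
  (forall A B : {set 'I_N}, B \subset X -> A \subset B -> F A \subset F B) ->
  (forall A : {set 'I_N}, A \subset X -> F A :&: X = A) ->
  (forall A : {set 'I_N}, A \subset X -> c (F A) = k) ->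
  has_mono_Qn_copy n c.
Proof.
move=> nX Fmono FX Fk.
pose g (i : 'I_n) : 'I_N := enum_val (widen_ord nX i).
have g_inj : injective g.
  by move=> i j /enum_val_inj/(congr1 val)/= ij; apply: val_inj.
have gX (A : {set 'I_n}) : g @: A \subset X.
  by apply/subsetP=> _ /imsetP[i _ ->]; apply: enum_valP.
have emb (A B : {set 'I_n}) : A \subset B <-> F (g @: A) \subset F (g @: B).
  split=> [AB|FAB]; first exact: Fmono (gX B) (imsetS _ AB).
  have gAB : g @: A \subset g @: B by rewrite -(FX _ (gX A)) -(FX _ (gX B)) setSI.
  apply/subsetP=> i iA; have /(subsetP gAB) := imset_f g iA.
  by rewrite mem_imset.
exists (fun A : {set 'I_n} => F (g @: A)), k; split; last by move=> A; apply: Fk.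
split=> // A B E; apply/eqP; rewrite eqEsubset.
by apply/andP; split; apply/emb; rewrite E.
Qed.

Lemma subset_I2 (A B : {set 'I_2}) :
  (A \subset B) = ((ord0 \in A) ==> (ord0 \in B)) && ((ord1_2 \in A) ==> (ord1_2 \in B)).
Proof.
apply/subsetP/andP=> [AB|[/implyP A0 /implyP A1] i]; first by split; apply/implyP/AB.
have [->|->] // : i = ord0 \/ i = ord1_2.
by case: i => [[|[|//]] ?]; [left|right]; apply: val_inj.
Qed.

Lemma Q2colE a b d e (A : {set 'I_2}) :
  Q2col a b d e A = if ord0 \in A then (if ord1_2 \in A then e else b)
                    else (if ord1_2 \in A then d else a).
Proof.
rewrite /Q2col !eqEsubset !subset_I2 !inE.
by case: (ord0 \in A); case: (ord1_2 \in A).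
Qed.

(** Incomparability of [A] and [B] is the only non-inclusion to check: any other reversed inclusion
    would make them comparable. *)
Lemma colored_copy N (c : coloring N) a b d e (S A B T : {set 'I_N}) :
  c S = a -> c A = b -> c B = d -> c T = e ->
  S \subset A -> S \subset B -> A \subset T -> B \subset T ->
  ~~ (A \subset B) -> ~~ (B \subset A) ->
  has_colored_Q2_copy c (Q2col a b d e).
Proof.
move=> cS cA cB cT SA SB AT BT nAB nBA.
pose f (W : {set 'I_2}) := if ord0 \in W then (if ord1_2 \in W then T else A)
                    else (if ord1_2 \in W then B else S).
have emb (V W : {set 'I_2}) : V \subset W <-> f V \subset f W.
  rewrite subset_I2 /f.
  have ST := subset_trans SA AT.
  have nAS : A \subset S = false.
    by apply/negP=> AS; case/negP: nAB; apply: subset_trans SB.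
  have nBS : B \subset S = false.
    by apply/negP=> BS; case/negP: nBA; apply: subset_trans SA.
  have nTS : T \subset S = false.
    by apply/negP=> TS; rewrite (subset_trans AT TS) in nAS.
  have nTA : T \subset A = false.
    by apply/negP=> TA; case/negP: nBA; apply: subset_trans TA.
  have nTB : T \subset B = false.
    by apply/negP=> TB; case/negP: nAB; apply: subset_trans TB.
  case: (ord0 \in V); case: (ord1_2 \in V); case: (ord0 \in W); case: (ord1_2 \in W);
  by rewrite /= ?subxx ?SA ?SB ?AT ?BT ?ST ?nAS ?nBS ?nTS ?nTA ?nTB ?(negbTE nAB) ?(negbTE nBA).
exists f; split; last first.
  by move=> W; rewrite Q2colE /f; case: (ord0 \in W); case: (ord1_2 \in W).
split=> // V W E; apply/eqP; rewrite eqEsubset.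
by apply/andP; split; apply/emb; rewrite E.
Qed.

(** * Lower bounds from a two-layered coloring *)

Lemma layered_no_copy N n (P : {set 'I_2} -> color) (A B : {set 'I_2}) :
  A \subset B -> P A = Red -> P B = Blue ->
  ~ has_colored_Q2_copy (fun D : {set 'I_N} => if #|D| < n then Blue else Red) P.
Proof.
move=> AB PA PB [f [[_ emb] fP]].
move: (fP A) (fP B) (subset_leq_card (proj1 (emb A B) AB)); rewrite PA PB.
by case: ltnP => // nA _; case: ltnP => // Bn _; lia.
Qed.

(** The size of the image grows by at least one whenever an element is added to the argument. *)
Lemma order_embedding_card k N (f : {set 'I_k} -> {set 'I_N}) (A : {set 'I_k}) :
  order_embedding f -> #|f set0| + #|A| <= #|f A|.
Proof.
move=> [f_inj emb]; move: {2}#|A| (erefl #|A|) => m.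
elim: m A => [|m IH] A Am.
  by rewrite Am addn0; apply/subset_leq_card/emb/sub0set.
have /card_gt0P[x xA] : 0 < #|A| by rewrite Am.
have Ax : #|A :\ x| = m by move: Am; rewrite (cardsD1 x) xA => -[].
have /proper_card : f (A :\ x) \proper f A.
  rewrite properEneq; apply/andP; split; last exact/emb/subD1set.
  by apply/eqP=> /f_inj/setP/(_ x); rewrite !inE eqxx xA.
by have := IH _ Ax; rewrite Ax Am; lia.
Qed.

(** A copy of [Q_n] spans more than [n] sizes, but blue sets have sizes below [n] and red ones sizes
    from [n] to [M < 2 * n]. *)
Lemma layered_no_mono M n :
  M < 2 * n ->
  ~ has_mono_Qn_copy n (fun D : {set 'I_M} => if #|D| < n then Blue else Red).
Proof.
move=> Mn [f [k [emb fk]]].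
have := order_embedding_card [set: _] emb.
rewrite cardsT card_ord => le; have := max_card (f setT); rewrite card_ord => leM.
move: (fk set0) (fk setT).
by case: ltnP => h1; case: ltnP => h2 ? ?; subst k => //; lia.
Qed.

Lemma EH_number_ge_of_red_below_blue n (P : {set 'I_2} -> color) (A B : {set 'I_2}) :
  A \subset B -> P A = Red -> P B = Blue -> EH_number_ge P n (2 * n).
Proof.
move=> AB PA PB M Mn /(_ (fun D => if #|D| < n then Blue else Red)) [].
  exact: layered_no_copy AB PA PB.
exact: layered_no_mono.
Qed.

(** * Blue intervals and the upper bounds for [brbb] and [brrb] *)

Lemma half_split N n : N = 2 * n ->
  exists2 X : {set 'I_N}, #|X| = n & #|~: X| = n.
Proof.
move=> ->; have [|X _ cX] := @subset_of_card _ [set: 'I_(2 * n)] n.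
  by rewrite cardsT card_ord; lia.
by exists X => //; have := cardsC X; rewrite card_ord; lia.
Qed.

(* Below every blue set [A] is used, above every blue set [A :|: Y]; only the
   sets [A] with [A] and [A :|: Y] enclosed between blue sets need [G]. *)
Lemma red_copy_off_blue_intervals N n (c : coloring N) (X Y : {set 'I_N})
    (G : {set 'I_N} -> {set 'I_N}) :
  n <= #|X| -> [disjoint X & Y] ->
  let enclosed (A : {set 'I_N}) := exists S T, [/\ c S = Blue, c T = Blue, S \subset A & A :|: Y \subset T] in
  (forall A : {set 'I_N}, A \subset X -> enclosed A ->
     [/\ A \subset G A, G A \subset A :|: Y & c (G A) = Red]) ->
  (forall A B : {set 'I_N}, A \subset B -> B \subset X -> enclosed A -> enclosed B -> G A \subset G B) ->
  has_mono_Qn_copy n c.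
Proof.
move=> nX dXY enclosed GP Gmono.
pose lo (A : {set 'I_N}) := [exists S, is_blue (c S) && (S \subset A)].
pose hi (A : {set 'I_N}) := [exists T, is_blue (c T) && (A \subset T)].
have enc A : lo A -> hi (A :|: Y) -> enclosed A.
  move=> /existsP[S /andP[/is_blueP cS SA]] /existsP[T /andP[/is_blueP cT AT]].
  by exists S, T.
have loS (A B : {set 'I_N}) : A \subset B -> lo A -> lo B.
  move=> AB /existsP[S /andP[cS SA]]; apply/existsP; exists S.
  by rewrite cS (subset_trans SA AB).
have hiS (A B : {set 'I_N}) : A \subset B -> hi B -> hi A.
  move=> AB /existsP[S /andP[cS SA]]; apply/existsP; exists S.
  by rewrite cS (subset_trans AB SA).
(* As [A] grows, [lo] can only switch on and [hi] only off, so the values come in the order [A],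
   [G A], [A :|: Y], which keeps [F] monotone. *)
pose F (A : {set 'I_N}) := if ~~ lo A then A else if hi (A :|: Y) then G A else A :|: Y.
have FAY (A : {set 'I_N}) : A \subset X -> A \subset F A /\ F A \subset A :|: Y.
  move=> AX; rewrite /F; case: ifP => [_|/negbFE l]; first by rewrite subsetUl.
  case: ifP => [h|_]; last by rewrite subsetUl.
  by have [] := GP A AX (enc _ l h).
apply: (@mono_copy _ _ _ Red X F nX).
- move=> A B BX AB; have AX := subset_trans AB BX.
  have [AF FA] := FAY A AX; have [BF FB] := FAY B BX.
  rewrite {1}/F; case: ifP => [_|/negbFE lA]; first exact: subset_trans BF.
  have ABY := setSU Y AB; have lB := loS _ _ AB lA.
  rewrite /F lB /=; case: ifP => hA; case: ifP => hB //.
  + by apply: Gmono => //; apply: enc.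
  + by have [_ GA _] := GP A AX (enc _ lA hA); apply: subset_trans ABY.
  + by rewrite (hiS _ _ ABY hB) in hA.
- move=> A AX; have [AF FA] := FAY A AX; apply/eqP; rewrite eqEsubset subsetI AF AX !andbT.
  apply: subset_trans (setSI X FA) _; rewrite setIUl subUset subsetIl.
  by rewrite setIC -setI_eq0 in dXY *; rewrite (eqP dXY) sub0set.
- move=> A AX; rewrite /F; case: ifP => [nl|/negbFE l].
    apply/is_redP; apply: contra nl => cA; apply/existsP; exists A; by rewrite cA subxx.
  case: ifP => [h|/negbT nh]; first by have [] := GP A AX (enc _ l h).
  by apply/is_redP; apply: contra nh => cA; apply/existsP; exists (A :|: Y); rewrite cA subxx.
Qed.

Lemma mono_interval N n (c : coloring N) k (S X : {set 'I_N}) :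
  n <= #|X| -> [disjoint X & S] ->
  (forall A : {set 'I_N}, A \subset X -> c (S :|: A) = k) -> has_mono_Qn_copy n c.
Proof.
move=> nX dXS cA; apply: (@mono_copy _ _ _ k X (fun A : {set _} => S :|: A) nX) => //.
  by move=> A B _; apply: setUS.
move=> A AX; rewrite setIUl (setIidPl AX).
by rewrite setIC -setI_eq0 in dXS *; rewrite (eqP dXS) set0U.
Qed.

Lemma incomparable_strict (T : finType) (A B : {set T}) a b :
  a \in A -> a \notin B -> b \in B -> b \notin A -> ~~ (A \subset B) /\ ~~ (B \subset A).
Proof. by move=> aA aB bB bA; split; apply/subsetPn; [exists a|exists b]. Qed.

(* For nested [A] and [B], the set [S] plus an element of [T] outside both is
   incomparable to both. *)
Lemma interior_monochromatic N (c : coloring N) (S T : {set 'I_N}) :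
  (forall A B : {set 'I_N}, S \subset A -> A \subset T -> S \subset B -> B \subset T ->
     ~~ (A \subset B) -> ~~ (B \subset A) -> c A = c B) ->
  forall A B : {set 'I_N}, S \proper A -> A \proper T -> S \proper B -> B \proper T -> c A = c B.
Proof.
move=> H A B SA AT SB BT.
have nested (A' B' : {set 'I_N}) : S \proper A' -> A' \subset B' -> B' \proper T -> c A' = c B'.
  move=> SA' AB BT'; have [ST' [t tT tB]] := properP BT'.
  have [SA'' [x xA xS]] := properP SA'.
  have SB' := subset_trans SA'' AB.
  have tA : t \notin A' by apply: contra tB; apply: (subsetP AB).
  have xt : x \notin t |: S.
    by rewrite !inE negb_or xS andbT; apply: contra tA => /eqP <-.
  have tU : t \in t |: S by rewrite setU11.
  have UT : t |: S \subset T by rewrite subUset sub1set tT (subset_trans SB').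
  have [n1 n2] := incomparable_strict xA xt tU tA.
  have [n3 n4] := incomparable_strict (subsetP AB x xA) xt tU tB.
  have AT' := subset_trans AB ST'.
  by rewrite (H A' (t |: S)) ?subsetUr // (H B' (t |: S)) ?subsetUr.
have [AB|nAB] := boolP (A \subset B); first exact: nested.
have [BA|nBA] := boolP (B \subset A); first by rewrite (nested B A).
by apply: H => //; apply: proper_sub.
Qed.

(** Incomparable interior sets of different colors would be the middle of a forbidden diamond.
    Keeping [a] and [e] free serves both [brbb] and [rrbb]. *)
Lemma mixed_pair_interior N (c : coloring N) a e (S T : {set 'I_N}) :
  ~ has_colored_Q2_copy c (Q2col a Red Blue e) -> c S = a -> c T = e ->
  forall A B : {set 'I_N}, S \proper A -> A \proper T -> S \proper B -> B \proper T -> c A = c B.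
Proof.
move=> nc cS cT; apply: interior_monochromatic => A B SA AT SB BT nAB nBA.
case cA: (c A); case cB: (c B) => //; case: nc.
- exact: (@colored_copy _ _ _ _ _ _ S B A T).
- exact: (@colored_copy _ _ _ _ _ _ S A B T).
Qed.

Lemma EH_brbb n : 0 < n -> EH_property Q2_brbb n (2 * n).
Proof.
move=> n0 c; case: (classic (has_colored_Q2_copy c Q2_brbb)) => [|nc]; [by left|right].
apply: NNPP => nm.
have [X cX cY] := @half_split (2 * n) n erefl.
(* A blue interior set would make the whole interval from [S] to [T] blue, of dimension at least
   [n]. *)
have red_interior (S T A : {set 'I_(2 * n)}) : c S = Blue -> c T = Blue -> n <= #|T :\: S| ->
    S \proper A -> A \proper T -> c A = Red.
  move=> cS cT nTS SA AT; case cA: (c A) => //; case: nm.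
  have ST := proper_sub (proper_trans SA AT).
  apply: (@mono_interval _ _ _ Blue S (T :\: S) nTS).
    by rewrite -setI_eq0 setIDAC setDIl setDv setI0.
  move=> B; rewrite subsetD => /andP[BT dBS].
  have [->|nS] := eqVneq (S :|: B) S; first exact: cS.
  have [->|nT] := eqVneq (S :|: B) T; first exact: cT.
  rewrite (mixed_pair_interior nc cS cT (A := S :|: B) (B := A)) // properEneq.
    by rewrite eq_sym nS subsetUl.
  by rewrite nT subUset ST BT.
(* One fixed [y] outside [X] moves each enclosed [A] strictly above [S], and into the red interior
   when [n > 1]. *)
have /card_gt0P[y yY] : 0 < #|~: X| by rewrite cY.
have encl (S T A : {set 'I_(2 * n)}) : A \subset X -> S \subset A -> A :|: ~: X \subset T ->
    n <= #|T :\: S|.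
  move=> AX SA AT; rewrite -[leqLHS]cY; apply/subset_leq_card/subsetP=> z; rewrite !inE => zX.
  rewrite (subsetP AT) ?inE ?zX ?orbT // andbT.
  by apply: contra zX => zS; apply/(subsetP AX)/(subsetP SA).
apply: (nm); apply: (@red_copy_off_blue_intervals _ _ _ X (~: X) (fun A : {set _} => y |: A)).
- by rewrite cX.
- by rewrite -setI_eq0 setICr.
- move=> A AX [S [T [cS cT SA AT]]].
  have nTS := encl _ _ _ AX SA AT.
  have yA : y \notin A by move: yY; rewrite inE; apply: contra; apply: (subsetP AX).
  split; [exact: subsetUr|by rewrite subUset subsetUl sub1set inE yY orbT|].
  have pSA : S \proper y |: A.
    by apply/properP; split; [apply: subset_trans SA (subsetUr _ _)|
       exists y; rewrite ?setU11 //; apply: contra yA; apply: (subsetP SA)].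
  have yAT : y |: A \subset T.
    by apply: subset_trans AT; rewrite subUset subsetUl sub1set inE yY orbT.
  have [n1|n2] := leqP n 1; last first.
    apply: (red_interior S T) => //; rewrite properEcard yAT /=.
    have : #|A| + n <= #|T|.
      rewrite -[Z in _ + Z]cY -(cardsUI A) (_ : A :&: ~: X = set0) ?cards0 ?addn0; first exact: subset_leq_card.
      by apply/eqP; rewrite setI_eq0 disjoints_subset setCK.
    by rewrite cardsU1 yA /= => le; lia.
  (* For [n = 1] the set [y |: A] may be [T] itself, but the blue sets [S] and [T] already form a
     copy of [Q_1]. *)
  case: nm; apply: (@mono_copy _ _ _ Blue [set y] (fun A : {set _} => if A == set0 then S else T)).
  + by rewrite cards1.
  + move=> B D _ BD; have ST := subset_trans (proper_sub pSA) yAT.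
    case: eqP => [_|/eqP Bn]; case: eqP => // E.
    by move: BD Bn; rewrite E subset0 => ->.
  + move=> B; rewrite subset1 => /orP[] /eqP->; rewrite ?eqxx.
      rewrite -cards_eq0 cards1; apply/setIidPr; rewrite sub1set.
      by apply: (subsetP yAT); rewrite setU11.
    apply/eqP; rewrite setI_eq0 disjoint_sym disjoints1.
    by apply: contra yA; apply: (subsetP SA).
  + by move=> B _; case: ifP.
- by move=> A B AB _ _ _; apply: setUS.
Qed.

Lemma EH_brrb n : 0 < n -> EH_property Q2_brrb n (2 * n).
Proof.
move=> n0 c; case: (classic (has_colored_Q2_copy c Q2_brrb)) => [|nc]; [by left|right].
apply: NNPP => nm.
have [X cX cY] := @half_split (2 * n) n erefl.
(* Red sets between blue [S] and [T] form a chain, so they share an element [e] outside [S]; the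
   sets of the interval avoiding [e] are all blue. *)
have short (S T : {set 'I_(2 * n)}) : c S = Blue -> c T = Blue -> S \subset T -> #|T :\: S| <= n.
  move=> cS cT ST; rewrite leqNgt; apply/negP => nTS.
  pose inred (R : {set 'I_(2 * n)}) := [&& ~~ is_blue (c R), S \subset R & R \subset T].
  have [e eTS eR] : exists2 e, e \in T :\: S & forall R, inred R -> e \in R.
    case: (pickP inred) => [R0 R0P|none]; last first.
      have /card_gt0P[e eTS] : 0 < #|T :\: S| by apply: leq_ltn_trans nTS.
      by exists e => // R; rewrite none.
    have [R /and3P[/is_redP cR SR RT] Rmin] := arg_minnP (fun R : {set _} => #|R|) R0P.
    have /properP[_ [e eR eS]] : S \proper R.
      by rewrite properEneq SR andbT; apply/eqP => E; rewrite E cR in cS.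
    exists e; first by rewrite inE eS (subsetP RT).
    move=> R' R'P; have leR := Rmin _ R'P; have /and3P[/is_redP cR' SR' R'T] := R'P.
    have [RR'|nRR'] := boolP (R \subset R'); first exact: (subsetP RR').
    have [R'R|nR'R] := boolP (R' \subset R); last first.
      by case: nc; apply: (@colored_copy _ _ _ _ _ _ S R R' T).
    by have /eqP-> : R' == R by rewrite eqEcard R'R leR.
  case: nm; apply: (@mono_interval _ _ _ Blue S ((T :\: S) :\ e)).
  - by move: nTS; rewrite (cardsD1 e) eTS.
  - rewrite disjoint_sym disjoints_subset; apply/subsetP => z zS.
    by rewrite !inE zS andbF.
  - move=> A AX; apply/is_blueP; apply/negPn/negP => cA.
    have : e \in S :|: A.
      apply: eR; rewrite /inred cA subsetUl subUset ST /=.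
      by apply: subset_trans AX _; apply: subset_trans (subD1set _ _) (subsetDl _ _).
    move: eTS; rewrite !inE => /andP[/negbTE-> _] /= /(subsetP AX).
    by rewrite !inE eqxx.
(* If [A] were smaller than [B], [T :\: S] would contain [~: X] and a further element of [B],
   exceeding size [n]. So distinct enclosed sets are incomparable, and monotonicity of [G] is
   automatic. *)
have grow (A B : {set 'I_(2 * n)}) S T : A \subset B -> B \subset X -> c S = Blue -> c T = Blue ->
    S \subset A -> B :|: ~: X \subset T -> A = B.
  move=> AB BX cS cT SA BT; apply/eqP; rewrite eqEsubset AB /=.
  apply/negPn/negP=> /subsetPn[z zB zA].
  have AT := subset_trans AB (subset_trans (subsetUl _ _) BT).
  have := short _ _ cS cT (subset_trans SA AT); rewrite leqNgt => /negP[].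
  have zX : z \notin ~: X by rewrite inE negbK (subsetP BX).
  have -> : n.+1 = #|z |: ~: X| by rewrite cardsU1 zX cY.
  apply/subset_leq_card/subsetP => w; rewrite 2!inE => wz.
  have wT : w \in T.
    by apply: (subsetP BT); case/orP: wz => [/eqP->|wX]; rewrite inE ?zB ?wX ?orbT.
  rewrite inE wT andbT; apply/negP => /(subsetP SA) wA.
  case/orP: wz => [/eqP E|]; first by rewrite -E wA in zA.
  by rewrite inE (subsetP BX) // (subsetP AB).
pose red_over (A Z : {set 'I_(2 * n)}) := [&& A \subset Z, Z \subset A :|: ~: X & ~~ is_blue (c Z)].
(* For [A] inside [X] the default is never reached: otherwise all sets from [A] to [A :|: ~: X] are
   blue. *)
pose G A := odflt A [pick Z | red_over A Z].
apply: (nm); apply: (@red_copy_off_blue_intervals _ _ _ X (~: X) G).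
- by rewrite cX.
- by rewrite -setI_eq0 setICr.
- move=> A AX _; rewrite /G; case: pickP => [Z /and3P[AZ ZA /is_redP cZ] //|none].
  case: nm; apply: (@mono_interval _ _ _ Blue A (~: X)); first by rewrite cY.
    by rewrite disjoint_sym disjoints_subset setCK.
  move=> B BX; apply/is_blueP; have := none (A :|: B).
  by rewrite /red_over subsetUl setUS //= => /negbFE.
- move=> A B AB BX [S [_ [cS _ SA _]]] [_ [T [_ cT _ BT]]].
  by rewrite (grow A B S T).
Qed.

(** * Duality and the upper bound for [rrbb] *)

Definition flip (k : color) := if k is Blue then Red else Blue.

(** Complementation reverses inclusion and the color swap restores red below blue, so the pattern
    [rrbb] is self-dual. *)
Definition dual_coloring N (c : coloring N) : coloring N := fun A : {set 'I_N} => flip (c (~: A)).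

Lemma dual_mono N n (c : coloring N) : has_mono_Qn_copy n (dual_coloring c) -> has_mono_Qn_copy n c.
Proof.
move=> [f [k [[finj emb] fk]]]; exists (fun A : {set 'I_n} => ~: f (~: A)), (flip k); split; last first.
  by move=> A; have := fk (~: A); rewrite /dual_coloring; case: (c _) => <-.
split=> [A B /setC_inj/finj/setC_inj //|A B].
by rewrite setCS -(setCS B A); apply: emb.
Qed.

(** The consequence of avoiding [rrbb], in a form invariant under [dual_coloring]. *)
Definition pinched N (c : coloring N) :=
  forall S T A B : {set 'I_N}, c S = Red -> c T = Blue ->
  S \proper A -> A \proper T -> S \proper B -> B \proper T -> c A = c B.

Lemma pinched_dual N (c : coloring N) : pinched c -> pinched (dual_coloring c).
Proof.
move=> pc S T A B cS cT SA AT SB BT; rewrite /dual_coloring.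
by rewrite (pc (~: T) (~: S) (~: A) (~: B)) ?properC ?setCK //;
  [move: cT|move: cS]; rewrite /dual_coloring; case: (c _).
Qed.

(** The element [a] is added once a blue [D] appears between [S] and [S :|: A]. If the result were
    blue, [D] and the red [a |: S] would be interior to one interval from red to blue, against
    [pinched]. *)
Lemma red_cover_pair N n (c : coloring N) (S : {set 'I_N}) a :
  pinched c -> c S = Red -> c (a |: S) = Red -> a \notin S -> n < #|~: S| ->
  has_mono_Qn_copy n c.
Proof.
move=> pc cS caS aS nS.
pose above (A : {set 'I_N}) := [exists B, [&& is_blue (c B), S \subset B & B \subset S :|: A]].
apply: (@mono_copy _ _ _ Red (~: S :\ a)
         (fun A : {set _} => if above A then a |: (S :|: A) else S :|: A)).
- by move: nS; rewrite (cardsD1 a) inE aS.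
- move=> A B BX AB; case: ifP => [/existsP[D /and3P[cD SD DA]]|_].
    have -> : above B.
      by apply/existsP; exists D; rewrite cD SD (subset_trans DA) // setUS.
    by rewrite !setUS.
  by case: ifP => _; [apply: subset_trans (subsetUr _ _)|]; rewrite setUS.
- move=> A AX; have dS : (S :|: A) :&: (~: S :\ a) = A.
    apply/setP=> z; have := subsetP AX z; rewrite !inE.
    by case: (z \in A) => [->|_] //; rewrite ?orbT ?orbF //; case: (z \in S); rewrite ?andbF.
  case: ifP => _ //; rewrite setIUl dS; apply/setUidPr/subsetP => z.
  by rewrite !inE => /andP[/eqP->]; rewrite eqxx.
- move=> A AX; case: ifP => [/existsP[D /and3P[/is_blueP cD SD DA]]|/negbT nab]; last first.
    apply/is_redP; apply: contra nab => cA; apply/existsP; exists (S :|: A).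
    by rewrite cA subsetUl subxx.
  case cA: (c _) => //.
  have /properP[_ [x xD xS]] : S \proper D.
    by rewrite properEneq SD andbT; apply/eqP=> E; rewrite E cD in cS.
  have aA : a \notin S :|: A.
    by rewrite inE negb_or aS /=; apply/negP => /(subsetP AX); rewrite !inE eqxx.
  have xA := subsetP DA x xD.
  suff : c D = c (a |: S) by rewrite cD caS.
  apply: (pc S (a |: (S :|: A))) => //.
  + by apply/properP; split=> //; exists x.
  + apply/properP; split; first exact: subset_trans DA (subsetUr _ _).
    by exists a; rewrite ?setU11 //; apply: contra aA; apply: (subsetP DA).
  + by apply/properP; split; [apply: subsetUr|exists a; rewrite ?setU11].
  + apply/properP; split; first by rewrite setUS // subsetUl.
    exists x; first by rewrite inE xA orbT.
    by rewrite !inE negb_or xS andbT; apply: contra aA => /eqP <-.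
Qed.

Lemma blue_cover_pair N n (c : coloring N) (T : {set 'I_N}) a :
  pinched c -> c T = Blue -> c (T :\ a) = Blue -> a \in T -> n < #|T| ->
  has_mono_Qn_copy n c.
Proof.
move=> pc cT caT aT nT; apply: dual_mono.
apply: (@red_cover_pair _ _ _ (~: T) a); rewrite ?setCK ?inE ?negbK //.
- exact: pinched_dual.
- by rewrite /dual_coloring setCK cT.
- by rewrite /dual_coloring setCU setCK setIC -setDE caT.
Qed.

Lemma EH_rrbb n : 0 < n -> EH_property Q2_rrbb n (2 * n).
Proof.
move=> n0 c; case: (classic (has_colored_Q2_copy c Q2_rrbb)) => [|nc]; [by left|right].
have pc : pinched c by move=> S T A B cS cT; apply: (mixed_pair_interior nc cS cT).
apply: NNPP => nm.
have cardC (A : {set 'I_(2 * n)}) : #|A| + #|~: A| = 2 * n by rewrite cardsC card_ord.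
have low_blue (S : {set 'I_(2 * n)}) : #|S| < n -> c S = Blue.
  move=> Sn; case cS: (c S) => //; case: (nm).
  have nS : n < #|~: S| by have := cardC S; lia.
  have [[a aS caS]|up_blue] : (exists2 a, a \notin S & c (a |: S) = Red) \/
      forall a, a \notin S -> c (a |: S) = Blue.
  - case: (pickP (fun a => (a \notin S) && ~~ is_blue (c (a |: S)))) => [a|none].
      by case/andP=> aS /is_redP ca; left; exists a.
    by right=> a aS; apply/is_blueP; have := none a; rewrite aS => /negbFE.
  - exact: red_cover_pair pc cS caS aS nS.
  (* Were [T] blue, [T :\ a] would be red by [blue_cover_pair], while [a |: S] is blue; both are
     interior to the interval from [S] to [T] because [#|S| < n < #|T|]. *)
  have high_red (T : {set 'I_(2 * n)}) : S \subset T -> n < #|T| -> c T = Red.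
    move=> ST nT; case cT: (c T) => //; case: nm.
    have cTS : #|T :\: S| = #|T| - #|S| by rewrite cardsDS.
    have /card_gt0P[a] : 0 < #|T :\: S| by lia.
    rewrite inE => /andP[aS aT].
    case cTa: (c (T :\ a)); first exact: (@blue_cover_pair _ _ _ T a).
    suff : c (a |: S) = c (T :\ a) by rewrite up_blue // cTa.
    have cU : #|a |: S| = #|S|.+1 by rewrite cardsU1 aS.
    have cD : #|T| = #|T :\ a|.+1 by rewrite (cardsD1 a) aT.
    apply: (pc S T) => //; rewrite properEcard.
    + by rewrite subsetUr cU /=.
    + by rewrite subUset sub1set aT ST cU (leq_ltn_trans Sn nT).
    + by rewrite subsetD1 ST aS -ltnS -cD (leq_ltn_trans Sn nT).
    + by rewrite subD1set cD /=.
  have [X XS cX] := subset_of_card (ltnW nS).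
  have SX : S \subset ~: X by rewrite -setCS setCK.
  (* The bottom is [S]; every other member is [~: X] with at least one more element, hence larger
     than [n]. *)
  apply: (@mono_copy _ _ _ Red X (fun A : {set _} => if A == set0 then S else ~: X :|: A)).
  - by rewrite cX.
  - move=> A B _ AB; case: eqP => [_|/eqP An]; case: eqP => [E|_] //.
    + exact: subset_trans SX (subsetUl _ _).
    + by move: AB An; rewrite E subset0 => ->.
    + exact: setUS.
  - move=> A AX; case: eqP => [->|_].
      by apply/eqP; rewrite setI_eq0 disjoints_subset.
    by rewrite setIUl setIC setICr set0U (setIidPl AX).
  - move=> A AX; case: eqP => [//|/eqP An]; apply: high_red.
      exact: subset_trans SX (subsetUl _ _).
    have := cardsUI (~: X) A; rewrite (_ : _ :&: A = set0) ?cards0; last first.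
      by apply/eqP; rewrite setIC setI_eq0 disjoints_subset setCK.
    by have := cardC X; rewrite -card_gt0 in An; lia.
have high_red (T : {set 'I_(2 * n)}) : n < #|T| -> c T = Red.
  move=> nT; case cT: (c T) => //; case: nm.
  have [X XT cX] := subset_of_card (ltnW nT).
  apply: (@mono_copy _ _ _ Blue X (fun A : {set _} => if A == X then T else A)).
  - by rewrite cX.
  - move=> A B BX AB; case: eqP => [E|_]; case: eqP => // nB.
      by case: nB; apply/eqP; rewrite eqEsubset BX -E.
    exact: subset_trans (subset_trans AB BX) XT.
  - by move=> A AX; case: eqP => [->|_]; [apply/setIidPr|apply/setIidPl].
  - move=> A AX; case: eqP => [//|/eqP AnX]; apply: low_blue.
    by rewrite -[ltnRHS]cX; apply: proper_card; rewrite properEneq AnX.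
have [X cX cY] := @half_split (2 * n) n erefl.
(* Only the layer of size [n] is undetermined: the color of [X] decides between the blue sets below
   it and the red sets above it. *)
case cXc: (c X); case: nm.
- apply: (@mono_interval _ _ _ Blue set0 X); rewrite ?cX ?disjoints_subset ?setC0 ?subsetT //.
  move=> A AX; rewrite set0U; have [->//|AnX] := eqVneq A X.
  by apply: low_blue; rewrite -[ltnRHS]cX; apply: proper_card; rewrite properEneq AnX.
- apply: (@mono_interval _ _ _ Red X (~: X)); rewrite ?cY ?disjoints_subset //.
  move=> A AX; have [->|An] := eqVneq A set0; first by rewrite setU0.
  apply: high_red; have := cardsUI X A; rewrite (_ : X :&: A = set0) ?cards0; last first.
    by apply/eqP; rewrite setIC setI_eq0 disjoints_subset.
  by rewrite -card_gt0 in An; lia.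
Qed.

(** * Blue chains along an ordering, and the upper bound for [rbbb] *)

Section BlueChains.

Variables (N : nat) (c : coloring N) (S : {set 'I_N}) (s : seq 'I_N).

Definition prefix_set i : {set 'I_N} := [set x in take i s].

(** The chain is read from its top: there are [B_0], ..., [B_i], each included in the next and the
    last in [A], with [S :|: B_j :|: prefix_set j] blue for all [j <= i]. *)
Fixpoint blue_chain (i : nat) (A : {set 'I_N}) : bool :=
  [exists B : {set 'I_N}, [&& B \subset A, is_blue (c (S :|: B :|: prefix_set i))
     & if i is j.+1 then blue_chain j B else true]].

Lemma blue_chainS i (A B : {set 'I_N}) : A \subset B -> blue_chain i A -> blue_chain i B.
Proof.
move=> AB; case: i => [|i] /= /existsP[D /and3P[DA cD chD]]; apply/existsP; exists D;
  by rewrite (subset_trans DA AB) cD.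
Qed.

Lemma blue_chain_le i j A : j <= i -> blue_chain i A ->
  exists2 B : {set 'I_N}, B \subset A & c (S :|: B :|: prefix_set j) = Blue.
Proof.
elim: i A => [|i IH] A.
  by rewrite leqn0 => /eqP-> /= /existsP[B /and3P[BA /is_blueP cB _]]; exists B.
rewrite leq_eqVlt => /orP[/eqP->|ji] /= /existsP[B /and3P[BA /is_blueP cB chB]]; first by exists B.
by have [D DB cD] := IH B ji chB; exists D => //; apply: subset_trans BA.
Qed.

(** The counting needs only the top [T] and one blue set under it for each prefix; the nesting among
    the latter is dropped. *)
Lemma blue_chain_top i A : blue_chain i A ->
  exists2 T : {set 'I_N}, T \subset A & c (S :|: T :|: prefix_set i) = Blue /\
    forall j, j <= i ->
    exists2 B : {set 'I_N}, B \subset T & c (S :|: B :|: prefix_set j) = Blue.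
Proof.
case: i => [|i] /= /existsP[T /and3P[TA /is_blueP cT chT]]; exists T => //; split=> // j.
  by rewrite leqn0 => /eqP->; exists T.
rewrite leq_eqVlt => /orP[/eqP->|ji]; first by exists T.
exact: (@blue_chain_le i j T).
Qed.

(* If no chain exists, [A] is sent to [A] plus the first prefix at which the
   blue chains below [A] stop. *)
Lemma red_copy_or_blue_chain n (X : {set 'I_N}) :
  n <= #|X| -> [disjoint X & S] -> [disjoint X & [set x in s]] ->
  has_mono_Qn_copy n c \/ blue_chain (size s) X.
Proof.
move=> nX dXS dXs; case: (boolP (blue_chain _ X)) => [|nX']; [by right|left].
pose bad A i := ~~ blue_chain i A.
pose l A := find (bad A) (iota 0 (size s).+1).
have lP (A : {set 'I_N}) : A \subset X -> has (bad A) (iota 0 (size s).+1).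
  move=> AX; apply/hasP; exists (size s); first by rewrite mem_iota add0n ltnSn.
  by apply: contra nX'; apply: blue_chainS.
have l_bad (A : {set 'I_N}) : A \subset X -> ~~ blue_chain (l A) A.
  move=> AX; have := nth_find 0 (lP A AX); rewrite nth_iota //.
  by have := lP A AX; rewrite has_find size_iota.
have l_ok (A : {set 'I_N}) i : A \subset X -> i < l A -> blue_chain i A.
  move=> AX il; have := before_find 0 il; rewrite nth_iota ?add0n.
    by move/negbFE.
  by apply: ltn_trans il _; have := lP A AX; rewrite has_find size_iota.
apply: (@mono_copy _ _ _ Red X (fun A : {set _} => S :|: A :|: prefix_set (l A)) nX).
- move=> A B BX AB; have AX := subset_trans AB BX.
  have lAB : l A <= l B.
    rewrite leqNgt; apply/negP => /(l_ok _ _ AX)/(blue_chainS AB).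
    by rewrite (negbTE (l_bad _ BX)).
  apply: setUSS; first exact: setUS.
  apply/subsetP=> x; rewrite !inE -[take (l A) s](take_takel _ lAB).
  exact: mem_take.
- move=> A AX; apply/setP=> x; rewrite !inE.
  have [xX|xX] := boolP (x \in X); last first.
    by rewrite andbF; apply/esym/negP => /(subsetP AX); apply/negP.
  rewrite andbT (disjointFr dXS xX) /=.
  have : x \in s = false by have := disjointFr dXs xX; rewrite inE.
  by move=> xs; rewrite [x \in take _ _](contraFF (@mem_take _ _ _ _) xs) orbF.
(* Were this set blue, [A] would prolong the chain for the preceding prefix, against the choice of
   [l A]. *)
- move=> A AX; apply/is_redP; apply: contra (l_bad _ AX) => cA.
  move: cA (l_ok A ^~ AX); case: (l A) => [|i] cA ok /=; apply/existsP; exists A;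
    by rewrite subxx cA // ok.
Qed.

End BlueChains.

(** The entry at position [i] is the one element that the prefix of length [i + 1] gains over that
    of length [i]. *)
Lemma prefix_set_inj (T : finType) (s t : seq T) :
  uniq s -> uniq t -> size s = size t ->
  (forall i, [set x in take i s] = [set x in take i t]) -> s = t.
Proof.
move=> us ut st E; case: s us st E => [|x0 s'] us st E; first by case: t st {ut E}.
set s := x0 :: s' in us st E *.
apply: (@eq_from_nth _ x0) => // i si.
have /setP/(_ (nth x0 s i)) := E i.+1; have /setP/(_ (nth x0 s i)) := E i.
have ti : i < size t by rewrite -st.
rewrite (take_nth x0 si) (take_nth x0 ti) !in_set !mem_rcons !in_cons eqxx /=.
have -> : nth x0 s i \in take i s = false.
  have := us; rewrite -{1}(cat_take_drop i s) cat_uniq => /and3P[_ /hasPn h _].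
  apply/negbTE/h; rewrite (drop_nth x0 si) mem_head //.
by move=> <-; rewrite orbF => /esym/eqP.
Qed.

(* The top of a blue chain determines the permutation, since the blue sets
   between [S] and a blue set are pairwise comparable. *)
Lemma red_copy_above_red N n k (c : coloring N) (S : {set 'I_N}) :
  ~ has_colored_Q2_copy c Q2_rbbb -> c S = Red -> n + k <= #|~: S| -> expn 2 n < k`! ->
  has_mono_Qn_copy n c.
Proof.
move=> nc cS nkS kn; apply: NNPP => nm.
have [X XS cX] := subset_of_card (leq_trans (leq_addr k n) nkS).
have [Y YS cY] : exists2 Y : {set 'I_N}, Y \subset ~: S :\: X & #|Y| = k.
  by apply: subset_of_card; rewrite cardsDS // cX; lia.
have dXS : [disjoint X & S] by rewrite disjoints_subset.
have permY s : s \in permutations (enum Y) -> [/\ uniq s, size s = k & [set x in s] = Y].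
  rewrite mem_permutations => ps; split.
  - by rewrite (perm_uniq ps) enum_uniq.
  - by rewrite (perm_size ps) -cardE.
  - by apply/setP=> x; rewrite inE (perm_mem ps) mem_enum.
pose top s (T : {set 'I_N}) := [&& T \subset X, is_blue (c (S :|: T :|: Y)) &
  [forall i : 'I_k.+1, exists B : {set 'I_N},
    (B \subset T) && is_blue (c (S :|: B :|: prefix_set s i))]].
pose t s := odflt set0 [pick T | top s T].
have topP s : s \in permutations (enum Y) -> top s (t s).
  move=> sP; have [us ss sY] := permY s sP.
  rewrite /t; case: pickP => [T //|none].
  have [||//|/blue_chain_top[T TX [cT chT]]] := @red_copy_or_blue_chain _ c S s n X _ dXS.
  - by rewrite cX.
  - rewrite sY disjoints_subset; apply/subsetP => x xX; rewrite inE.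
    by apply/negP=> /(subsetP YS); rewrite inE xX.
  have := none T; rewrite /top TX /=.
  have -> : Y = prefix_set s (size s) by rewrite /prefix_set take_size.
  rewrite cT /= => /negP[]; apply/forallP => i; apply/existsP.
  have [|B BT cB] := chT i; first by rewrite ss -ltnS.
  by exists B; rewrite BT cB.
(* For equal tops, two blue sets with the same [i] lie between red [S] and the same blue set, so
   they are comparable; restricted to [Y], this compares prefixes of equal size. *)
have t_inj : {in permutations (enum Y) &, injective t}.
  move=> s s' sP s'P E; have [us ss sY] := permY s sP; have [us' ss' sY'] := permY s' s'P.
  apply: prefix_set_inj => //; first by rewrite ss ss'.
  move=> i; have [ik|ki] := ltnP i k.+1; last first.
    by rewrite !take_oversize ?ss ?ss' ?(ltnW ki) // sY sY'.
  have subY (s1 : seq 'I_N) : [set x in s1] = Y -> prefix_set s1 i \subset Y.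
    by move=> <-; apply/subsetP=> x; rewrite !inE; apply: mem_take.
  have card_prefix (s1 : seq 'I_N) : uniq s1 -> size s1 = k -> #|prefix_set s1 i| = i.
    move=> us1 ss1; rewrite cardsE (card_uniqP _) ?take_uniq // size_take ss1.
    by case: ltnP => //; lia.
  have prefix_sub (s1 s2 : seq 'I_N) (B1 B2 : {set 'I_N}) : [set x in s1] = Y -> B2 \subset X ->
      S :|: B1 :|: prefix_set s1 i \subset S :|: B2 :|: prefix_set s2 i ->
      prefix_set s1 i \subset prefix_set s2 i.
    move=> s1Y B2X sub; apply/subsetP=> x xs1.
    have := subsetP YS x (subsetP (subY _ s1Y) x xs1); rewrite 2!inE => /andP[xX xS].
    have := subsetP sub x; rewrite !in_setU xs1 orbT (negbTE xS) /= => /(_ isT)/orP[/(subsetP B2X)|].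
      by rewrite (negbTE xX).
    by rewrite inE.
  have /and3P[TX /is_blueP cT /forallP/(_ (Ordinal ik))/existsP[B /andP[BT /is_blueP cB]]] :=
    topP s sP.
  have := topP s' s'P; rewrite -E.
  case/and3P=> _ _ /forallP/(_ (Ordinal ik))/existsP[B' /andP[B'T /is_blueP cB']].
  have pU : forall (B1 : {set 'I_N}) (s1 : seq 'I_N), B1 \subset t s -> [set x in s1] = Y ->
      S :|: B1 :|: prefix_set s1 i \subset S :|: t s :|: Y.
    by move=> B1 s1 B1T s1Y; rewrite setUSS ?subY // setUS.
  have SU (B1 : {set 'I_N}) (s1 : seq 'I_N) : S \subset S :|: B1 :|: prefix_set s1 i by rewrite -setUA subsetUl.
  apply/eqP.
  have [sub|nsub] := boolP (S :|: B :|: prefix_set s i \subset S :|: B' :|: prefix_set s' i).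
    rewrite eqEcard (prefix_sub _ _ _ _ sY (subset_trans B'T TX) sub) /=.
    by rewrite [X in _ <= X]card_prefix // [X in X <= _]card_prefix.
  have [sub'|nsub'] := boolP (S :|: B' :|: prefix_set s' i \subset S :|: B :|: prefix_set s i).
    rewrite eq_sym eqEcard (prefix_sub _ _ _ _ sY' (subset_trans BT TX) sub') /=.
    by rewrite [X in _ <= X]card_prefix // [X in X <= _]card_prefix.
  by case: nc; apply: (colored_copy cS cB cB' cT); rewrite ?SU ?pU.
(* The [k!] permutations inject into the [2 ^ n] subsets of [X]. *)
have : size (map t (permutations (enum Y))) <= size (enum (powerset X)).
  apply: uniq_leq_size; first by rewrite map_inj_in_uniq ?permutations_uniq.
  move=> _ /mapP[s sP ->]; rewrite mem_enum powersetE.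
  by case/and3P: (topP s sP).
rewrite size_map size_permutations ?enum_uniq // -!cardE card_powerset cX cY.
by rewrite leqNgt kn.
Qed.

Lemma EH_rbbb n k : expn 2 n < k`! -> EH_property Q2_rbbb n (2 * n + k).
Proof.
move=> kn c; case: (classic (has_colored_Q2_copy c Q2_rbbb)) => [|nc]; [by left|right].
case: (pickP (fun S : {set 'I_(2 * n + k)} => ~~ is_blue (c S) && (#|S| <= n))) => [S|none].
  (* At least [n + k] elements lie outside [S]: [n] for the cube and [k] for the permuted set. *)
  case/andP=> /is_redP cS Sn; apply: (red_copy_above_red nc cS _ kn).
  by have := cardsC S; rewrite card_ord; lia.
have [|X _ cX] := @subset_of_card _ [set: 'I_(2 * n + k)] n.
  by rewrite cardsT card_ord; lia.
apply: (@mono_interval _ _ _ Blue set0 X); rewrite ?cX ?disjoints_subset ?setC0 ?subsetT //.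
move=> A AX; rewrite set0U; apply/is_blueP; have := none A.
by rewrite (leq_trans (subset_leq_card AX)) ?cX // andbT => /negbFE.
Qed.

(** * Factorial estimates and the asymptotic bound *)

Lemma pow2_lt_fact n : expn 2 n < (n + 2)`!.
Proof.
elim: n => [//|n IH]; rewrite addSn factS expnS.
by apply: leq_trans (leq_mul (_ : 2 <= (n + 2).+1) IH) => //; lia.
Qed.

(** Each of the last [m] factors of the factorial exceeds [j]. *)
Lemma expn_le_fact j m : expn j m <= (j + m)`!.
Proof.
elim: m => [|m IH]; first by rewrite expn0 fact_gt0.
by rewrite addnS factS expnS leq_mul // leqW // leq_addr.
Qed.

(* [k! >= j^(k-j)] with [j = 2^q] about the square root of [n]. *)
Lemma pow2_lt_fact_small n : 4 <= n ->
  exists k q, [/\ 0 < q, n < expn 2 (4 * q), expn 2 n < k`! & k * (4 * q) <= 12 * n].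
Proof.
move=> n4; pose q := trunc_log 4 n.
have /andP[qn nq] : (expn 4 q <= n < expn 4 q.+1).
  by apply: trunc_log_bounds => //; lia.
have q0 : 0 < q by rewrite /q trunc_log_gt0; lia.
have E : expn 4 q = expn 2 q * expn 2 q by rewrite -expnMn.
(* The exponent [n %/ q + 1] is chosen so that its product with [q] exceeds [n]. *)
exists (expn 2 q + (n %/ q).+1), q; split => //.
- apply: leq_trans nq _; rewrite -[X in expn X _]/(expn 2 2) -expnM leq_exp2l //; lia.
- apply: leq_trans (expn_le_fact _ _); rewrite -expnM ltn_exp2l //.
  by rewrite mulnC; apply: ltn_ceil.
(* Each of [2 ^ q * q], [(n %/ q) * q] and [q] is at most [n]; three such terms, times [4], give the
   constant [12]. *)
- have := leq_divM n q; have := ltn_expl q (isT : 1 < 2).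
  move: E qn; move: (expn 4 q) (expn 2 q) (n %/ q) => a b d -> ? ? ?; nia.
Qed.

(** Rests on [2 <= e]; it turns [n < 2 ^ (4 * q)] into [ln n <= 4 * q]. *)
Lemma INR_pow2_le_exp m : (INR (expn 2 m) <= exp (INR m))%R.
Proof.
elim: m => [|m IH]; first by rewrite exp_0; apply: Rle_refl.
rewrite expnS mult_INR (S_INR m) exp_plus [(exp _ * _)%R]Rmult_comm.
have e2 : (INR 2 <= exp 1)%R by have := exp_ineq1_le 1; rewrite /=; lra.
by apply: Rmult_le_compat => //; apply: pos_INR.
Qed.

Lemma EH_rbbb_asymptotic n : 4 <= n ->
  EH_number_le_R Q2_rbbb n (2 * INR n + 12 * (INR n / ln (INR n)))%R.
Proof.
move=> n4; have [k [q [q0 nq kfact kq]]] := pow2_lt_fact_small n4.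
exists (2 * n + k); split; last exact: EH_rbbb.
have n1 : (1 < INR n)%R by apply: (lt_INR 1); lia.
have ln0 : (0 < ln (INR n))%R by rewrite -ln_1; apply: ln_increasing; lra.
have lnq : (ln (INR n) <= INR (4 * q))%R.
  rewrite -[INR (4 * q)]ln_exp; apply/Rlt_le/ln_increasing; first lra.
  by apply: Rlt_le_trans (INR_pow2_le_exp _); apply: lt_INR; lia.
have kqR : (INR k * INR (4 * q) <= 12 * INR n)%R.
  have -> : 12%R = INR 12 by rewrite /=; lra.
  by rewrite -!mult_INR; apply: le_INR; lia.
rewrite plus_INR mult_INR (_ : INR 2 = 2)%R //.
apply: Rplus_le_compat_l.
apply: (Rmult_le_reg_r _ _ _ ln0).
have -> : (12 * (INR n / ln (INR n)) * ln (INR n) = 12 * INR n)%R by field; lra.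
by apply: Rle_trans kqR; apply: Rmult_le_compat_l => //; apply: pos_INR.
Qed.

Theorem theorem7 :
  (forall n : nat, 0 < n ->
     EH_number_is Q2_brbb n (2 * n) /\
     EH_number_is Q2_brrb n (2 * n) /\
     EH_number_is Q2_rrbb n (2 * n) /\
     EH_number_exists Q2_rbbb n /\
     EH_number_ge Q2_rbbb n (2 * n)) /\
  (exists (C : R) (n0 : nat), forall n : nat, n0 <= n ->
     EH_number_le_R Q2_rbbb n
       (2 * INR n + C * (INR n / ln (INR n)))%R).
Proof.
split=> [n n0|]; last by exists 12%R, 4; apply: EH_rbbb_asymptotic.
(* The red vertex below a blue one is a middle vertex for [brbb] and [brrb], the minimum for [rrbb]
   and [rbbb]. *)
have red_mid_blue_max a d : EH_number_ge (Q2col a Red d Blue) n (2 * n).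
  by apply: (EH_number_ge_of_red_below_blue (subsetT [set ord0])); rewrite Q2colE !inE.
have red_min_blue_max b d : EH_number_ge (Q2col Red b d Blue) n (2 * n).
  by apply: (EH_number_ge_of_red_below_blue (sub0set setT)); rewrite Q2colE !inE.
split; first by split; [apply: EH_brbb|apply: red_mid_blue_max].
split; first by split; [apply: EH_brrb|apply: red_mid_blue_max].
split; first by split; [apply: EH_rrbb|apply: red_min_blue_max].
split; last exact: red_min_blue_max.
by exists (2 * n + (n + 2)); apply/EH_rbbb/pow2_lt_fact.
Qed.
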